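(* Let $T\in L(H)$ be an operator satisfying hypothesis $(h)$, and let $B=\{h\in H: h \text{ is algebraic with respect to } T \text{ over } A\}$. If $H_T$ is a Hilbert module over $A$ with a generating set $\{h_1,\dots,h_k\}$ ($k<\infty$) and $h_i\in B$ for $i=1,2,\dots,k$, then $H_T=B$ and $T$ is a $C_0$-operator relative to $\Omega$.
   Context: $\Omega$ is a bounded finitely connected region in $\mathbb{C}$ whose boundary $\partial\Omega$ consists of a finite number of disjoint, analytic, simple closed curves. $H$ is a complex Hilbert space and $L(H)$ is the algebra of bounded linear operators on $H$. $H^\infty(\Omega)$ is the Banach algebra of bounded holomorphic functions on $\Omega$ with the supremum norm; via nontangential boundary values it is identified with a weak$^*$-closed subalgebra of $L^\infty(\partial\Omega)$ (with respect to harmonic measure for a fixed point of $\Omega$), from which it receives its weak$^*$ topology. Hypothesis $(h)$: $T\in L(H)$ satisfies hypothesis $(h)$ if $\overline{\Omega}$ is a spectral set for $T$ (i.e. $\sigma(T)\subseteq\overline{\Omega}$ and $\|r(T)\|\le \max_{z\in\overline\Omega}|r(z)|$ for every rational function $r=p/q$ with poles off $\overline{\Omega}$, where $r(T)=q(T)^{-1}p(T)$) and $T$ has no normal summand with spectrum in $\partial\Omega$ (i.e. there is no nonzero reducing subspace $N$ of $T$ with $T|N$ normal and $\sigma(T|N)\subseteq\partial\Omega$). Functional calculus: for $T$ satisfying $(h)$ there is a unique algebra representation $f\mapsto f(T)$ of $H^\infty(\Omega)$ into $L(H)$ with $1(T)=I_H$, $z(T)=T$, continuous for the weak$^*$ topologies,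 and contractive. $T$ satisfying $(h)$ is a $C_0$-operator relative to $\Omega$ (of class $C_0$ relative to $\Omega$) if there is $u\in H^\infty(\Omega)\setminus\{0\}$ with $u(T)=0$. $A$ denotes a function algebra on $\overline{\Omega}$ (a closed subalgebra of $C(\overline\Omega)$ containing the constants and separating points) which contains every polynomial and satisfies $A\subset H^\infty(\Omega)$. $H_T$ denotes $H$ regarded as a Hilbert module over $A$ with module action $f.h=f(T)h$ ($f\in A$, $h\in H$). A set $\{h_\delta\}_{\delta\in\Gamma}\subset H_T$ is a generating set for $H_T$ if the finite sums $\sum_i f_i.h_{\delta_i}$ ($f_i\in A$, $\delta_i\in\Gamma$) are dense in $H_T$. An element $h\in H$ is algebraic with respect to $T$ over $A$ if $\theta(T)h=0$ for some $\theta\in A\setminus\{0\}$. *)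

(* Defs.v *)
From HB Require Import structures.
From mathcomp Require Import all_boot all_order all_algebra.
From mathcomp Require Import sesquilinear complex.
From mathcomp Require Import all_classical all_reals all_analysis.

Set Implicit Arguments.
Unset Strict Implicit.
Unset Printing Implicit Defensive.

Import Order.TTheory GRing.Theory Num.Theory.
Import numFieldNormedType.Exports.

Local Open Scope classical_set_scope.
Local Open Scope ring_scope.
Local Open Scope complex_scope.

(* A name for R[i] as a numClosedFieldType, from which it gets the topology and
   the normed module structure given by its modulus. *)
Definition Cplx (R : realType) : numClosedFieldType := R[i].

Definition Cborel (R : realType) := g_sigma_algebraType (@open (Cplx R)).

Section plane.
Context {R : realType}.
Local Notation C := (Cplx R).
Implicit Types (Omega K U : set C) (f g phi : C -> C) (z w zeta : C).

Definition boundary Omega : set C := closure Omega `\` Omega°.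

Definition holomorphic_on U f := forall z, U z -> derivable f z 1.

Definition unit_circle : set C := [set z | `|z| = 1].

Definition analytic_simple_closed_curve (Gamma : set C) :=
  exists U phi, [/\ open U, unit_circle `<=` U, holomorphic_on U phi,
    set_inj unit_circle phi &
    (forall z, unit_circle z -> derive1 phi z != 0) /\
    Gamma = phi @` unit_circle].

Record analytic_domain Omega : Prop := AnalyticDomain {
  domain_neq0 : Omega !=set0 ;
  domain_open : open Omega ;
  domain_connected : connected Omega ;
  domain_bounded : bounded_set Omega ;
  (* Omega being bounded, its complements in the plane and in the Riemann
     sphere have the same number of components *)
  domain_finitely_connected : finite_set
    [set connected_component (~` Omega) z | z in ~` Omega] ;
  domain_boundary : exists (n : nat) (Gamma : 'I_n -> set C),
    [/\ forall i, analytic_simple_closed_curve (Gamma i),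
        trivIset [set: 'I_n] Gamma &
        boundary Omega = \bigcup_i Gamma i] }.

(* Elements of H^oo(Omega), and below of C(K), are represented by functions on
   the whole plane, considered up to equality on Omega, resp. on K. *)
Definition Hinfty Omega : set (C -> C) :=
  [set f | holomorphic_on Omega f /\
           exists M : C, forall z, Omega z -> `|f z| <= M].

Definition dx (u : C -> R) z : R := derive1 (fun t : R => u (z + (t +i* 0))) 0.
Definition dy (u : C -> R) z : R := derive1 (fun t : R => u (z + (0 +i* t))) 0.

Definition C1_on Omega (u : C -> R) := forall z, Omega z ->
  [/\ derivable (fun t : R => u (z + (t +i* 0))) 0 1,
      derivable (fun t : R => u (z + (0 +i* t))) 0 1,
      {for z, continuous (dx u)} & {for z, continuous (dy u)}].

Definition harmonic_on Omega (u : C -> R) :=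
  [/\ C1_on Omega u, C1_on Omega (dx u), C1_on Omega (dy u) &
      forall z, Omega z -> dx (dx u) z + dy (dy u) z = 0].

Definition harmonic_measure Omega z0 (omega : probability (Cborel R) R) :=
  omega (boundary Omega) = 1%E /\
  forall u : C -> R, {within closure Omega, continuous u} ->
    harmonic_on Omega u ->
    u z0 = \int[omega]_(zeta in boundary Omega) u zeta.

Definition Cintegral (omega : probability (Cborel R) R) (D : set C) f : C :=
  (\int[omega]_(zeta in D) complex.Re (f zeta)) +i*
  (\int[omega]_(zeta in D) complex.Im (f zeta)).

Definition Cintegrable (omega : probability (Cborel R) R) (D : set C) f :=
  omega.-integrable D (fun zeta => (complex.Re (f zeta))%:E) /\
  omega.-integrable D (fun zeta => (complex.Im (f zeta))%:E).

(* the points z of Omega with |z - zeta| < a * dist (z, boundary Omega) *)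
Definition approach_region Omega (a : C) zeta : set C :=
  [set z | Omega z /\ forall w, boundary Omega w -> `|z - zeta| < a * `|z - w|].

Definition nontangential_limit Omega f zeta (l : C) :=
  forall a : C, 1 < a ->
    f z @[z --> within (approach_region Omega a zeta) (nbhs zeta)] --> l.

(* By Fatou's theorem, the default value 0 is only used on a set of harmonic
   measure 0 if f is in H^oo(Omega). *)
Definition boundary_value Omega f zeta : C :=
  xget 0 [set l | nontangential_limit Omega f zeta l].

(* Convergence of a filter in the weak-* topology of H^oo(Omega), i.e. the
   topology induced by sigma(L^oo(omega), L^1(omega)). *)
Definition Hinfty_weakstar_cvg Omega (omega : probability (Cborel R) R)
    (F : set_system (C -> C)) f :=
  forall g, Cintegrable omega (boundary Omega) g ->
    Cintegral omega (boundary Omega)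
      (fun zeta => boundary_value Omega u zeta * g zeta) @[u --> F] -->
    Cintegral omega (boundary Omega)
      (fun zeta => boundary_value Omega f zeta * g zeta).

Record function_algebra K (A : set (C -> C)) : Prop := FunctionAlgebra {
  falg_continuous : forall f, A f -> {within K, continuous f} ;
  falg_cst : forall c : C, A (fun=> c) ;
  falg_add : forall f g, A f -> A g -> A (fun z => f z + g z) ;
  falg_mul : forall f g, A f -> A g -> A (fun z => f z * g z) ;
  (* in particular, membership in A only depends on the values on K *)
  falg_closed : @closed {uniform` K -> C} A ;
  falg_separates : forall z w, K z -> K w -> z <> w ->
    exists2 f, A f & f z <> f w }.

End plane.

Section operators.
Context {R : realType} {H : completeNormedModType (Cplx R)}.
Local Notation C := (Cplx R).
Implicit Types (N : set H) (S T V : H -> H) (p q : {poly C}).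

Definition bounded_operator_on N S :=
  [/\ forall x, N x -> N (S x),
      forall (a : C) x y, N x -> N y -> S (a *: x + y) = a *: S x + S y &
      exists M : C, forall x, N x -> `|S x| <= M * `|x|].

Definition inverse_on N S V :=
  bounded_operator_on N V /\ forall x, N x -> V (S x) = x /\ S (V x) = x.

(* the spectrum of the restriction of S to the invariant subspace N *)
Definition spectrum_on N S : set C :=
  [set lambda | ~ exists V, inverse_on N (fun x => S x - lambda *: x) V].

Definition spectrum S : set C := spectrum_on [set: H] S.

Definition op_poly p S (x : H) : H := \sum_(i < size p) p`_i *: iter i S x.

Definition spectral_set (K : set C) T :=
  spectrum T `<=` K /\
  forall p q, (forall z, K z -> q.[z] != 0) ->
  forall V, inverse_on [set: H] (op_poly q T) V ->
  forall M : C, (forall z, K z -> `|p.[z] / q.[z]| <= M) ->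
  forall x, `|V (op_poly p T x)| <= M * `|x|.

Variable ip : {dot H for (@Num.conj C)}.

Definition orthogonal_complement N : set H :=
  [set y | forall x, N x -> ip x y = 0].

Record reducing T N : Prop := Reducing {
  reducing0 : N 0 ;
  reducing_linear : forall (a : C) x y, N x -> N y -> N (a *: x + y) ;
  reducing_closed : closed N ;
  reducing_stable : forall x, N x -> N (T x) ;
  reducing_stable_orth : forall x,
    orthogonal_complement N x -> orthogonal_complement N (T x) }.

(* S is the adjoint of the restriction of T to N *)
Definition normal_on N T :=
  exists S, [/\ bounded_operator_on N S,
    forall x y, N x -> N y -> ip (T x) y = ip x (S y) &
    forall x, N x -> T (S x) = S (T x)].

Definition hypothesis_h (Omega : set C) T :=
  spectral_set (closure Omega) T /\
  forall N, reducing T N -> normal_on N T ->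
    spectrum_on N T `<=` boundary Omega -> N = [set 0].

Definition square_summable (x : nat -> H) :=
  cvgn (series (fun n => `|x n| ^+ 2 : C)).

(* Convergence in the weak-* topology of L(H), the dual of the trace class
   operators \sum_n <., y n> x n with square summable x and y. *)
Definition op_weakstar_cvg (I : Type) (F : set_system I)
    (S : I -> H -> H) T :=
  forall x y : nat -> H, square_summable x -> square_summable y ->
    limn (series (fun n => ip (S i (x n)) (y n))) @[i --> F] -->
    limn (series (fun n => ip (T (x n)) (y n))).

(* Phi f stands for f(T); its values outside H^oo(Omega) are irrelevant. *)
Record Hinfty_calculus (Omega : set C) (omega : probability (Cborel R) R)
    T (Phi : (C -> C) -> {linear H -> H}) : Prop := HinftyCalculus {
  calc_continuous : forall f, Hinfty Omega f -> continuous (Phi f) ;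
  calc_ext : forall f g, Hinfty Omega f -> Hinfty Omega g ->
    {in Omega, f =1 g} -> Phi f =1 Phi g ;
  calc_add : forall f g, Hinfty Omega f -> Hinfty Omega g ->
    forall x, Phi (fun z => f z + g z) x = Phi f x + Phi g x ;
  calc_scale : forall (c : C) f, Hinfty Omega f ->
    forall x, Phi (fun z => c * f z) x = c *: Phi f x ;
  calc_mul : forall f g, Hinfty Omega f -> Hinfty Omega g ->
    forall x, Phi (fun z => f z * g z) x = Phi f (Phi g x) ;
  calc_one : forall x, Phi (fun=> 1) x = x ;
  calc_id : forall x, Phi (fun z => z) x = T x ;
  calc_contractive : forall f (M : C), Hinfty Omega f ->
    (forall z, Omega z -> `|f z| <= M) -> forall x, `|Phi f x| <= M * `|x| ;
  calc_weakstar : forall (F : set_system (C -> C)) f, ProperFilter F ->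
    F (Hinfty Omega) -> Hinfty Omega f ->
    Hinfty_weakstar_cvg Omega omega F f ->
    op_weakstar_cvg F (fun u => Phi u : H -> H) (Phi f) }.

End operators.

Section modules.
Context {R : realType} {H : completeNormedModType (Cplx R)}.
Local Notation C := (Cplx R).
Variables (K : set C) (A : set (C -> C)) (act : (C -> C) -> H -> H).

(* The sup norm topology of A is the one induced by uniform convergence on K. *)
Record hilbert_module : Prop := HilbertModule {
  hmod_ext : forall f g, A f -> A g -> {in K, f =1 g} -> act f =1 act g ;
  hmod_linear : forall f (a : C) x y, A f ->
    act f (a *: x + y) = a *: act f x + act f y ;
  hmod_add : forall f g x, A f -> A g ->
    act (fun z => f z + g z) x = act f x + act g x ;
  hmod_mul : forall f g x, A f -> A g ->
    act (fun z => f z * g z) x = act f (act g x) ;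
  hmod_cst : forall (c : C) x, act (fun=> c) x = c *: x ;
  hmod_continuous :
    {within [set fx : {uniform` K -> C} * H | A fx.1],
      continuous (fun fx : {uniform` K -> C} * H => act fx.1 fx.2)} }.

Definition generating_set (Gamma : Type) (h : Gamma -> H) :=
  dense [set x | exists (n : nat) (f : 'I_n -> C -> C) (delta : 'I_n -> Gamma),
    (forall i, A (f i)) /\ x = \sum_(i < n) act (f i) (h (delta i))].

Definition algebraic_element (h : H) := exists theta : C -> C,
  [/\ A theta, exists2 z, K z & theta z != 0 & act theta h = 0].

End modules.

Definition C0_operator {R : realType} {H : completeNormedModType (Cplx R)}
    (Omega : set (Cplx R)) (Phi : (Cplx R -> Cplx R) -> {linear H -> H}) :=
  exists u : Cplx R -> Cplx R,
    [/\ Hinfty Omega u, exists2 z, Omega z & u z != 0 & forall x, Phi u x = 0].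

(* Main.v *)
Require Import Defs.
From mathcomp Require Import all_boot all_order all_algebra.
From mathcomp Require Import sesquilinear complex.
From mathcomp Require Import all_classical all_reals all_analysis.
From mathcomp Require Import ring lra.
Import Order.TTheory GRing.Theory Num.Theory.
Import numFieldNormedType.Exports.
Local Open Scope classical_set_scope.
Local Open Scope ring_scope.
Local Open Scope complex_scope.

Set Implicit Arguments.
Unset Strict Implicit.
Unset Printing Implicit Defensive.

(** Each generator [h i] is annihilated by some nonzero [theta_i] in [A]. The product
    [theta] of the [theta_i] annihilates all generators since the action of [A] is
    commutative; it then annihilates the submodule that they generate, hence [H] by
    density and continuity of [theta(T)]. Thus every vector is algebraic and
    [theta(T) = 0] with [theta] in [A], a part of [H^oo(Omega)].

    The point is that [theta] is not zero. A function in [A] which is not zero on the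
    closure of [Omega] is not zero on [Omega], by continuity. For two functions that
    are holomorphic and not zero on the connected set [Omega], the product is not
    zero either ([holomorphic_zero_divisor_free]): this is the identity theorem
    ([identity_theorem]), proved here from complex differentiability alone and
    without Cauchy's integral formula, as follows.

    Goursat's bisection ([goursat]) gives a function [f] that is differentiable on a
    square a primitive [F] there. As [f] has first-order expansions, [F] has
    second-order ones ([primitive_expands2]). Functions with second-order expansions
    form an algebra, and they satisfy the maximum principle ([max_Re], [max_cmod]),
    by comparing a value with the mean over four symmetric points. If [f] vanishes
    near [0], then [F - F 0] divided by [z ^+ n] belongs to this class for all [n];
    the maximum principle and the limit in [n] show that [F] is constant on a disc of
    fixed radius, so that [f] vanishes there ([vanishing_spreads]). The zeros of [f]
    then spread to all of [Omega] by connectedness. *)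

(** * Modulus *)

Section modulus.
Context {R : realType}.
Local Notation C := (Cplx R).
Implicit Types z w : C.

(** The norm of a complex number is itself an element of [Cplx R], which is only
    partially ordered; estimates use its value in the ordered field [R]. *)
Definition cmod z : R := Num.sqrt (complex.Re z ^+ 2 + complex.Im z ^+ 2).

Lemma normE z : `|z| = (cmod z)%:C.
Proof. exact: normc_def. Qed.

Lemma cmod_ge0 z : 0 <= cmod z.
Proof. exact: sqrtr_ge0. Qed.

Lemma cmodM z w : cmod (z * w) = cmod z * cmod w.
Proof. by apply: complexI; rewrite rmorphM/= -!normE normrM. Qed.

Lemma cmodD z w : cmod (z + w) <= cmod z + cmod w.
Proof. by rewrite -lecR rmorphD/= -!normE ler_normD. Qed.

Lemma cmodN z : cmod (- z) = cmod z.
Proof. by apply: complexI; rewrite -!normE normrN. Qed.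

Lemma cmodR (a : R) : cmod (a%:C : C) = `|a|.
Proof. by rewrite /cmod/= expr0n addr0 sqrtr_sqr. Qed.

Lemma cmod_eq0 z : (cmod z == 0) = (z == 0).
Proof. by rewrite -[RHS]normr_eq0 normE -(inj_eq (@complexI R)). Qed.

Lemma cmod0 : cmod 0 = 0.
Proof. by apply/eqP; rewrite cmod_eq0. Qed.

Lemma cmodX z n : cmod (z ^+ n) = cmod z ^+ n.
Proof. by apply: complexI; rewrite rmorphXn/= -!normE normrX. Qed.

Lemma cmod_i : cmod ('i : C) = 1.
Proof. by rewrite /cmod/= expr0n add0r expr1n sqrtr1. Qed.

Lemma ler_Re z : `|complex.Re z| <= cmod z.
Proof. by rewrite -sqrtr_sqr ler_sqrt ?lerDl ?addr_ge0 ?sqr_ge0. Qed.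

Lemma ler_Im z : `|complex.Im z| <= cmod z.
Proof. by rewrite -sqrtr_sqr ler_sqrt ?lerDr ?addr_ge0 ?sqr_ge0. Qed.

Lemma cmod_le z : cmod z <= `|complex.Re z| + `|complex.Im z|.
Proof.
rewrite -(@ler_pXn2r _ 2%N) ?nnegrE ?sqrtr_ge0 ?addr_ge0//.
rewrite sqr_sqrtr ?addr_ge0 ?sqr_ge0// sqrrD !real_normK ?num_real//.
by rewrite addrAC lerDl mulrn_wge0// mulr_ge0.
Qed.

(** Turns the filters of the topology of [Cplx R], whose balls have complex
    radii, into epsilon-delta statements with real epsilon and delta. *)
Lemma nbhs_cmodP z (P : set C) :
  nbhs z P <-> exists2 e : R, 0 < e & forall h, cmod h < e -> P (z + h).
Proof.
split=> [/nbhs_ballP[e e0 eP]|[e e0 eP]].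
  have eR : e = (complex.Re e)%:C by rewrite RRe_real// gtr0_real.
  exists (complex.Re e); first by rewrite -ltcR -eR.
  move=> h he; apply: eP; rewrite -ball_normE/= opprD addNKr normrN.
  by rewrite normE eR ltcR.
apply/nbhs_ballP; exists e%:C; first by rewrite /= ltcR.
move=> w; rewrite -ball_normE/= distrC normE ltcR => /eP.
by rewrite addrC subrK.
Qed.

End modulus.

(** * Primitives on the real line *)

Section one_variable.
Context {R : realType}.
Local Notation C := (Cplx R).

Lemma antiderivative (a b : R) (g : R -> R) :
  (forall x, a <= x <= b -> {for x, continuous g}) ->
  exists G, forall x, a < x < b -> is_derive x 1 G (g x).
Proof.
move=> gc; exists (fun x => \int[lebesgue_measure]_(t in `[a, x]) g t) => x.
move=> /andP[ax xb].
have ig : lebesgue_measure.-integrable `[a, b] (EFin \o g).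
  apply: continuous_compact_integrable; first exact: segment_compact.
  by apply: continuous_in_subspaceT => y; rewrite inE/= in_itv/= => /gc.
have [|dG <-] := continuous_FTC1_closed xb ig ax.
  by apply: gc; rewrite !ltW.
by rewrite derive1E; exact/derivableP.
Qed.

(** The mean value theorem applied to the difference between [G] and a quadratic
    primitive of the affine function [c0 + c1 x]. The interval of points at
    distance at most [d] from [p] is used because it contains all the points
    between [s] and [t], whatever their order. *)
Lemma increment_le (a b : R) (G g : R -> R) (c0 c1 p d K s t : R) :
  (forall x, a < x < b -> is_derive x 1 G (g x)) ->
  a < s < b -> a < t < b -> `|s - p| <= d -> `|t - p| <= d ->
  (forall x, a < x < b -> `|x - p| <= d -> `|g x - (c0 + c1 * x)| <= K) ->
  `|G t - G s - (c0 * (t - s) + c1 / 2 * (t ^+ 2 - s ^+ 2))| <= K * `|t - s|.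
Proof.
move=> dG; wlog st : s t / s <= t => [wl|] sab tab sd td gK.
  have [/wl|/ltW /wl] := leP s t; first exact.
  move=> /(_ tab sab td sd gK); rewrite (distrC s); apply: le_trans.
  by rewrite -normrN le_eqVlt; apply/orP; left; apply/eqP; congr (`| _ |); ring.
pose D x := G x - (c0 * x + c1 / 2 * x ^+ 2).
have dD x : a < x < b -> is_derive x 1 D (g x - (c0 + c1 * x)).
  move=> /dG ?; apply: is_derive_eq.
  by rewrite /GRing.scale/=; lra.
have [x||c] := @MVT_segment _ D (fun x => g x - (c0 + c1 * x)) s t st.
- by rewrite in_itv/= => /andP[? ?]; apply: dD; lra.
- apply: derivable_within_continuous => x; rewrite in_itv/= => xst.
  by apply: (@ex_derive _ _ _ _ _ _ _ (dD x _)); lra.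
- rewrite in_itv/= => cst DE.
have -> : G t - G s - (c0 * (t - s) + c1 / 2 * (t ^+ 2 - s ^+ 2)) = D t - D s.
  by rewrite /D; ring.
rewrite DE normrM ler_wpM2r// gK//; first lra.
by move: sd td; rewrite !ler_norml; lra.
Qed.

Lemma increment_cmod_le (a b : R) (G g : R -> C) (c0 c1 : C) (p d K s t : R) :
  (forall x, a < x < b ->
     is_derive x 1 (fun y => complex.Re (G y)) (complex.Re (g x)) /\
     is_derive x 1 (fun y => complex.Im (G y)) (complex.Im (g x))) ->
  a < s < b -> a < t < b -> `|s - p| <= d -> `|t - p| <= d ->
  (forall x, a < x < b -> `|x - p| <= d -> cmod (g x - (c0 + c1 * x%:C)) <= K) ->
  cmod (G t - G s - (c0 * (t - s)%:C + c1 / 2 * (t ^+ 2 - s ^+ 2)%:C))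
    <= 2 * K * `|t - s|.
Proof.
move=> dG sab tab sd td gK.
have half (z : C) : z / 2 = (complex.Re z / 2) +i* (complex.Im z / 2).
  apply/(mulIf (_ : (2 : C) != 0)); rewrite ?pnatr_eq0// divfK ?pnatr_eq0//.
  by case: z => u v; rewrite mulr_natr; apply/eqP; rewrite eq_complex/=; lra.
have ReE (z w c e : C) (u v : R) :
    complex.Re (z - w - (c * u%:C + e / 2 * v%:C)) = complex.Re z -
    complex.Re w - (complex.Re c * u + complex.Re e / 2 * v).
  by rewrite half; case: z w c e => ? ? [? ?] [? ?] [? ?] /=; ring.
have ImE (z w c e : C) (u v : R) :
    complex.Im (z - w - (c * u%:C + e / 2 * v%:C)) = complex.Im z -
    complex.Im w - (complex.Im c * u + complex.Im e / 2 * v).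
  by rewrite half; case: z w c e => ? ? [? ?] [? ?] [? ?] /=; ring.
have ReE1 (z c e : C) (u : R) : complex.Re (z - (c + e * u%:C)) =
    complex.Re z - (complex.Re c + complex.Re e * u).
  by case: z c e => ? ? [? ?] [? ?] /=; ring.
have ImE1 (z c e : C) (u : R) : complex.Im (z - (c + e * u%:C)) =
    complex.Im z - (complex.Im c + complex.Im e * u).
  by case: z c e => ? ? [? ?] [? ?] /=; ring.
apply: (le_trans (cmod_le _)); rewrite ReE ImE.
have -> : 2 * K * `|t - s| = K * `|t - s| + K * `|t - s| by ring.
have dR x h := (dG x h).1; have dI x h := (dG x h).2.
by apply: lerD; [
  apply: (increment_le dR sab tab sd td) => x xab xd |
  apply: (increment_le dI sab tab sd td) => x xab xd];
  apply: le_trans (gK _ xab xd); rewrite -?ReE1 -?ImE1 ?ler_Re ?ler_Im.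
Qed.

End one_variable.

(** * Integrals along the axes *)

Section goursat.
Context {R : realType}.
Local Notation C := (Cplx R).
Implicit Types (f F : C -> C) (z p a b : C).

Definition closed_square p (d : R) : set C :=
  [set z | `|complex.Re z - complex.Re p| <= d /\
           `|complex.Im z - complex.Im p| <= d].

Definition open_square (r : R) : set C :=
  [set z | `|complex.Re z| < r /\ `|complex.Im z| < r].

(** The antiderivative of the affine function [a + b (z - p)]. *)
Definition affine_primitive p a b z : C := a * z + b / 2 * (z - p) ^+ 2.

Lemma cartE (x y : R) : (x +i* y : C) = x%:C + 'i * y%:C.
Proof. by apply/eqP; rewrite eq_complex/=; apply/andP; split; apply/eqP; ring. Qed.

Lemma sqri : ('i : C) ^+ 2 = -1.
Proof. exact: sqr_i. Qed.

Lemma cmod_le_closed_square z h (d : R) : cmod h <= d -> closed_square z d (z + h).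
Proof.
by move=> hd; split; rewrite raddfD/= addrC addKr (le_trans _ hd) ?ler_Re ?ler_Im.
Qed.

Lemma continuous_slices f z : {for z, continuous f} ->
  [/\ {for complex.Re z, continuous (fun x => complex.Re (f (x +i* complex.Im z)))},
      {for complex.Re z, continuous (fun x => complex.Im (f (x +i* complex.Im z)))},
      {for complex.Im z, continuous (fun y => complex.Re (f (complex.Re z +i* y)))} &
      {for complex.Im z, continuous (fun y => complex.Im (f (complex.Re z +i* y)))}].
Proof.
move=> fc.
have near e : 0 < e -> exists2 d : R, 0 < d & forall w, cmod (w - z) < d ->
    cmod (f z - f w) <= e.
  move=> e0; have /fc : nbhs (f z) [set w | cmod (f z - w) <= e].
    apply/nbhs_cmodP; exists e => // h he /=.
    by rewrite opprD addrA subrr sub0r cmodN ltW.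
  move=> /nbhs_cmodP[d d0 dP]; exists d => // w wd.
  by have := dP _ wd; rewrite /= (addrC z) subrK.
case: z fc near => x0 y0 /= fc near.
have cx x : cmod ((x +i* y0 : C) - (x0 +i* y0)) = `|x0 - x|.
  by rewrite -(distrC x) -cmodR; congr cmod; apply/eqP; rewrite eq_complex/= subrr !eqxx.
have cy y : cmod ((x0 +i* y : C) - (x0 +i* y0)) = `|y0 - y|.
  rewrite -(distrC y) -cmodR -[RHS]mul1r -cmod_i -cmodM; congr cmod.
  by apply/eqP; rewrite eq_complex/= subrr; apply/andP; split; apply/eqP; ring.
split; apply/cvgrPdist_le => e /near[d d0 dP];
  apply/nbhs_ballP; exists d => // x; rewrite /ball/= -?cx -?cy => /dP;
  apply: le_trans; rewrite -raddfB.
- exact: (ler_Re (f _ - f _)).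
- exact: (ler_Im (f _ - f _)).
- exact: (ler_Re (f _ - f _)).
- exact: (ler_Im (f _ - f _)).
Qed.

(** [X] and [Y] stand for integrals of [f dz] along horizontal and vertical lines.
    All that is used about them is this comparison: where [f] is [K]-close to an
    affine function, their increments are close to those of its antiderivative.
    The case [K = 0], [a = b = 0] covers functions that vanish locally. *)
Definition axis_increments (r : R) f (X Y : R -> R -> C) := forall (p a b : C) (d K : R),
  (forall z, open_square r z -> closed_square p d z ->
     cmod (f z - (a + b * (z - p))) <= K) ->
  (forall s t y, open_square r (s +i* y) -> open_square r (t +i* y) ->
     closed_square p d (s +i* y) -> closed_square p d (t +i* y) ->
     cmod (X t y - X s y - (affine_primitive p a b (t +i* y) -
                            affine_primitive p a b (s +i* y)))
       <= 2 * K * `|t - s|) /\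
  (forall x s t, open_square r (x +i* s) -> open_square r (x +i* t) ->
     closed_square p d (x +i* s) -> closed_square p d (x +i* t) ->
     cmod (Y x t - Y x s - (affine_primitive p a b (x +i* t) -
                            affine_primitive p a b (x +i* s)))
       <= 2 * K * `|t - s|).

(** Only continuity is needed on each line. Since [dz = i dy] on a vertical line,
    [Y] is [i] times an antiderivative of [f]. *)
Lemma axis_primitives (r : R) f :
  (forall z, closed_square 0 r z -> {for z, continuous f}) ->
  exists X Y, axis_increments r f X Y.
Proof.
move=> fc.
have sq x y : `|x| <= r -> `|y| <= r -> closed_square 0 r (x +i* y).
  by rewrite /closed_square/= !subr0.
have ax (g : R -> R -> R) :
    (forall y x, `|y| <= r -> `|x| <= r -> {for x, continuous (g y)}) ->
    exists G : R -> R -> R, forall y, `|y| <= r -> forall x, - r < x < r ->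
      is_derive x 1 (G y) (g y x).
  move=> gc.
  have /choice[G GP] : forall y, exists Gy : R -> R, `|y| <= r ->
      forall x, - r < x < r -> is_derive x 1 Gy (g y x).
    move=> y; have [yr|_] := boolP (`|y| <= r); last by exists id.
    have [|Gy GyP] := @antiderivative _ (- r) r (g y); last by exists Gy.
    by move=> x xr; apply: gc => //; rewrite ler_norml.
  by exists G.
have [|U UP] := ax (fun y x => complex.Re (f (x +i* y))).
  by move=> y x yr xr; case: (continuous_slices (fc _ (sq _ _ xr yr))).
have [|V VP] := ax (fun y x => complex.Im (f (x +i* y))).
  by move=> y x yr xr; case: (continuous_slices (fc _ (sq _ _ xr yr))).
have [|U' U'P] := ax (fun x y => complex.Re (f (x +i* y))).
  by move=> x y xr yr; case: (continuous_slices (fc _ (sq _ _ xr yr))).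
have [|V' V'P] := ax (fun x y => complex.Im (f (x +i* y))).
  by move=> x y xr yr; case: (continuous_slices (fc _ (sq _ _ xr yr))).
exists (fun x y => U y x +i* V y x), (fun x y => 'i * (U' x y +i* V' x y)).
move=> p a b d K fK.
split=> [s t y [/= sr yr] [/= tr _] [/= sd yd] [/= td _]|
         x s t [/= xr sr] [/= _ tr] [/= xd sd] [/= _ td]].
- have dG x : - r < x < r -> is_derive x 1 (U y) (complex.Re (f (x +i* y))) /\
    is_derive x 1 (V y) (complex.Im (f (x +i* y))).
    by move=> xr; split; [exact: UP (ltW yr) _ xr|exact: VP (ltW yr) _ xr].
  have := @increment_cmod_le _ (- r) r (fun x => U y x +i* V y x)
    (fun x => f (x +i* y)) (a + b * ('i * y%:C - p)) b (complex.Re p) d K s t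
    dG _ _ sd td.
  rewrite -!ltr_norml => /(_ sr tr) H.
  have -> : affine_primitive p a b (t +i* y) - affine_primitive p a b (s +i* y) =
    (a + b * ('i * y%:C - p)) * (t - s)%:C + b / 2 * (t ^+ 2 - s ^+ 2)%:C.
    by rewrite /affine_primitive !cartE !rmorphB !rmorphXn/=; field.
  apply: H => x; rewrite -ltr_norml => xr xd.
  have -> : a + b * ('i * y%:C - p) + b * x%:C = a + b * (x +i* y - p).
    by rewrite cartE; ring.
  exact: fK.
- have dG y : - r < y < r -> is_derive y 1 (U' x) (complex.Re (f (x +i* y))) /\
    is_derive y 1 (V' x) (complex.Im (f (x +i* y))).
    by move=> yr; split; [exact: U'P (ltW xr) _ yr|exact: V'P (ltW xr) _ yr].
  have := @increment_cmod_le _ (- r) r (fun y => U' x y +i* V' x y)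
    (fun y => f (x +i* y)) (a + b * (x%:C - p)) (b * 'i) (complex.Im p) d K s t
    dG _ _ sd td.
  rewrite -!ltr_norml => /(_ sr tr) H.
  have -> : affine_primitive p a b (x +i* t) - affine_primitive p a b (x +i* s) =
    'i * ((a + b * (x%:C - p)) * (t - s)%:C +
          (b * 'i) / 2 * (t ^+ 2 - s ^+ 2)%:C).
    by rewrite /affine_primitive !cartE !rmorphB !rmorphXn/=; field.
  rewrite -mulrBr -mulrBr cmodM cmod_i mul1r.
  apply: H => y; rewrite -ltr_norml => yr yd.
  have -> : a + b * (x%:C - p) + b * 'i * y%:C = a + b * (x +i* y - p).
    by rewrite cartE; ring.
  exact: fK.
Qed.

End goursat.

(** * Goursat's lemma for rectangles *)

Section circulation.
Context {R : realType}.
Local Notation C := (Cplx R).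
Implicit Types (f F : C -> C) (z : C).

Definition affine_approx f p b := forall e : R, 0 < e ->
  exists2 d : R, 0 < d &
    forall h, cmod h < d -> cmod (f (p + h) - (f p + b * h)) <= e * cmod h.

Lemma derivable_affine_approx f p : derivable f p 1 -> exists b, affine_approx f p b.
Proof.
move=> /cvg_ex[b bP]; exists b => e e0.
have /bP : nbhs b [set w | cmod (w - b) <= e].
  apply/nbhs_cmodP; exists e => // h he /=.
  by rewrite addrC addKr ltW.
move=> /nbhs_cmodP[d d0 dP]; exists d => // h hd.
have [->|h0] := eqVneq h 0.
  by rewrite mulr0 !addr0 subrr cmod0 mulr0.
have /= := dP h hd; rewrite add0r => /(_ h0).
rewrite /GRing.scale/= mulr1 => H.
have -> : f (p + h) - (f p + b * h) = (h^-1 * (f (h + p) - f p) - b) * h.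
  by rewrite (addrC p h); field.
by rewrite cmodM ler_wpM2r ?cmod_ge0.
Qed.

Lemma nested_halving (a : nat -> R) (w : R) : 0 <= w ->
  (forall n, a n <= a n.+1 <= a n + w / 2 ^+ n.+1) ->
  exists p, forall n, a n <= p <= a n + w / 2 ^+ n.
Proof.
move=> w0 aP.
pose c n := a n + w / 2 ^+ n.
have a_incr : {homo a : m n / (m <= n)%N >-> m <= n}.
  by apply: homo_leq => [//|? ? ?|n]; [exact: le_trans|case/andP: (aP n)].
have c_decr : {homo c : m n / (m <= n)%N >-> n <= m}.
  apply: homo_leq => [//|? ? ? /[swap]|n]; first exact: le_trans.
  have /andP[_] := aP n; rewrite /c exprSr invfM mulrA; lra.
have ac m n : a m <= c n.
  apply: (le_trans (a_incr _ _ (leq_maxl m n))).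
  apply: le_trans (c_decr _ _ (leq_maxr m n)).
  by rewrite /c lerDl divr_ge0 ?exprn_ge0.
have a_sup : has_sup (range a).
  by split; [exists (a 0%N); exists 0%N|exists (c 0%N) => _ [m _ <-]].
exists (sup (range a)) => n; apply/andP; split.
  by apply: (ub_le_sup (proj2 a_sup)); exists n.
by apply: (ge_sup (proj1 a_sup)) => _ [m _ <-]; exact: ac.
Qed.

(** Goursat's bisection for a subadditive quantity [q] attached to rectangles,
    given by a corner and two side lengths: keeping each time a quarter that
    carries at least a fourth of [q], the rectangles shrink to a point. *)
Lemma quadrisection (q : R -> R -> R -> R -> R) (a0 b0 w h : R) :
  (forall a b w h, q a b w h <=
     q a b (w / 2) (h / 2) + q (a + w / 2) b (w / 2) (h / 2) +
     (q a (b + h / 2) (w / 2) (h / 2) + q (a + w / 2) (b + h / 2) (w / 2) (h / 2))) ->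
  0 <= w -> 0 <= h ->
  exists p1 p2, [/\ a0 <= p1 <= a0 + w, b0 <= p2 <= b0 + h & forall n,
    exists a b, [/\ a <= p1 <= a + w / 2 ^+ n, b <= p2 <= b + h / 2 ^+ n &
      q a0 b0 w h <= 4 ^+ n * q a b (w / 2 ^+ n) (h / 2 ^+ n)]].
Proof.
move=> qP w0 h0.
have step (nab : nat * (R * R)) : exists ab' : R * R,
    let: (n, (a, b)) := nab in
    [/\ a <= ab'.1 <= a + w / 2 ^+ n.+1, b <= ab'.2 <= b + h / 2 ^+ n.+1 &
     q a b (w / 2 ^+ n) (h / 2 ^+ n) <=
     4 * q ab'.1 ab'.2 (w / 2 ^+ n.+1) (h / 2 ^+ n.+1)].
  case: nab => n [a b].
  have half (u : R) : u / 2 ^+ n.+1 = u / 2 ^+ n / 2 by rewrite exprSr invfM mulrA.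
  rewrite !half.
  have : 0 <= w / 2 ^+ n by rewrite divr_ge0 ?exprn_ge0.
  have : 0 <= h / 2 ^+ n by rewrite divr_ge0 ?exprn_ge0.
  move: (w / 2 ^+ n) (h / 2 ^+ n) => {}w {}h {}h0 {}w0.
  have := qP a b w h.
  have [q1 _|] := leP (q a b w h) (4 * q a b (w / 2) (h / 2)).
    by exists (a, b) => /=; split=> //; lra.
  have [q1 _ _|] := leP (q a b w h) (4 * q (a + w / 2) b (w / 2) (h / 2)).
    by exists (a + w / 2, b) => /=; split=> //; lra.
  have [q1 _ _ _|] := leP (q a b w h) (4 * q a (b + h / 2) (w / 2) (h / 2)).
    by exists (a, b + h / 2) => /=; split=> //; lra.
  by exists (a + w / 2, b + h / 2) => /=; split=> //; lra.
have [g gP] := choice step.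
pose ab := fix ab n := if n is m.+1 then g (m, ab m) else (a0, b0).
have abP n : [/\ (ab n).1 <= (ab n.+1).1 <= (ab n).1 + w / 2 ^+ n.+1,
    (ab n).2 <= (ab n.+1).2 <= (ab n).2 + h / 2 ^+ n.+1 &
     q (ab n).1 (ab n).2 (w / 2 ^+ n) (h / 2 ^+ n) <=
     4 * q (ab n.+1).1 (ab n.+1).2 (w / 2 ^+ n.+1) (h / 2 ^+ n.+1)].
  by have /= := gP (n, ab n); case: (ab n).
have [|p1 p1P] := @nested_halving (fun n => (ab n).1) w w0.
  by move=> n; case: (abP n).
have [|p2 p2P] := @nested_halving (fun n => (ab n).2) h h0.
  by move=> n; case: (abP n).
exists p1, p2; split.
- by have := p1P 0%N; rewrite expr0 divr1.
- by have := p2P 0%N; rewrite expr0 divr1.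
- move=> n; exists (ab n).1, (ab n).2; split=> //.
  elim: n => [|n IH]; first by rewrite !expr0 !divr1 mul1r.
  apply: (le_trans IH); rewrite exprSr -mulrA ler_wpM2l ?exprn_ge0//.
  by case: (abP n).
Qed.

(** The integral of [f dz] along the boundary of a rectangle. As it is written with
    values of [X] and [Y] at the corners, its additivity under subdivision is an
    identity between sums. *)
Definition circulation (X Y : R -> R -> C) (x x' y y' : R) : C :=
  (X x' y - X x y) - (X x' y' - X x y') + (Y x' y' - Y x' y) - (Y x y' - Y x y).

(** The antiderivative of an affine function has no circulation, hence only the
    error of the affine approximation contributes: there are four sides of length
    at most [2 d], and each contributes at most [2 K] times its length. *)
Lemma circulation_le r f X Y (p a b : C) (d K x x' y y' : R) : axis_increments r f X Y ->
  (forall z, open_square r z -> closed_square p d z ->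
     cmod (f z - (a + b * (z - p))) <= K) ->
  0 <= K ->
  open_square r (x +i* y) -> open_square r (x' +i* y') ->
  closed_square p d (x +i* y) -> closed_square p d (x' +i* y') ->
  cmod (circulation X Y x x' y y') <= 16 * K * d.
Proof.
move=> XY fK K0 [/= xr yr] [/= xr' yr'] [/= xd yd] [/= xd' yd'].
have [XP YP] := XY _ _ _ _ _ fK.
set Q := affine_primitive p a b in XP YP.
have -> : circulation X Y x x' y y' =
    (X x' y - X x y - (Q (x' +i* y) - Q (x +i* y)))
  + - (X x' y' - X x y' - (Q (x' +i* y') - Q (x +i* y')))
  + ((Y x' y' - Y x' y - (Q (x' +i* y') - Q (x' +i* y)))
  + - (Y x y' - Y x y - (Q (x +i* y') - Q (x +i* y)))).
  by rewrite /circulation; ring.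
apply: (le_trans (cmodD _ _)); apply: (le_trans (lerD (cmodD _ _) (cmodD _ _))).
rewrite !cmodN.
have xx : `|x' - x| <= 2 * d by move: xd xd'; rewrite !ler_norml; lra.
have yy : `|y' - y| <= 2 * d by move: yd yd'; rewrite !ler_norml; lra.
have h1 := XP x x' y (conj xr yr) (conj xr' yr) (conj xd yd) (conj xd' yd).
have h2 := XP x x' y' (conj xr yr') (conj xr' yr') (conj xd yd') (conj xd' yd').
have h3 := YP x' y y' (conj xr' yr) (conj xr' yr') (conj xd' yd) (conj xd' yd').
have h4 := YP x y y' (conj xr yr) (conj xr yr') (conj xd yd) (conj xd yd').
have := ler_wpM2l (mulr_ge0 (ler0n R 2) K0) xx.
have := ler_wpM2l (mulr_ge0 (ler0n R 2) K0) yy.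
lra.
Qed.

(** At the limit point of the quadrisection, differentiability makes the
    circulation [o(s^2)] on rectangles of size [s], whereas the bisection of a nonzero
    circulation keeps it above a positive multiple of [s^2]. *)
Lemma goursat r f X Y x x' y y' : axis_increments r f X Y ->
  (forall z, open_square r z -> exists b, affine_approx f z b) ->
  open_square r (x +i* y) -> open_square r (x' +i* y') ->
  circulation X Y x x' y y' = 0.
Proof.
move=> XY fa; wlog xx : x x' / x <= x' => [wl|].
  have [/wl|/ltW x'x] := leP x x'; first exact.
  move=> [/= xr yr] [/= xr' yr']; have := wl _ _ x'x (conj xr' yr) (conj xr yr').
  by move=> /(congr1 -%R); rewrite oppr0 => <-; rewrite /circulation; ring.
wlog yy : y y' / y <= y' => [wl|].
  have [/wl|/ltW y'y] := leP y y'; first exact.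
  move=> [/= xr yr] [/= xr' yr']; have := wl _ _ y'y (conj xr yr') (conj xr' yr).
  by move=> /(congr1 -%R); rewrite oppr0 => <-; rewrite /circulation; ring.
move=> [/= xr yr] [/= xr' yr'].
pose q a b w h := cmod (circulation X Y a (a + w) b (b + h)).
have qP a b w h : q a b w h <=
     q a b (w / 2) (h / 2) + q (a + w / 2) b (w / 2) (h / 2) +
     (q a (b + h / 2) (w / 2) (h / 2) + q (a + w / 2) (b + h / 2) (w / 2) (h / 2)).
  apply: le_trans (lerD (cmodD _ _) (cmodD _ _)).
  apply: le_trans (cmodD _ _).
  rewrite -!addrA -!splitr le_eqVlt; apply/orP; left; apply/eqP; congr cmod.
  by rewrite /circulation; ring.
have w0 : 0 <= x' - x by rewrite subr_ge0.
have h0 : 0 <= y' - y by rewrite subr_ge0.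
have [p1 [p2 [p1P p2P pP]]] := @quadrisection q x y _ _ qP w0 h0.
have [p1r p2r] : `|p1| < r /\ `|p2| < r.
  by move: xr yr xr' yr'; rewrite !ltr_norml; lra.
have [b bP] := fa (p1 +i* p2) (conj p1r p2r).
apply/eqP; rewrite -cmod_eq0 eq_le cmod_ge0 andbT.
set w := x' - x in w0 p1P pP; set h := y' - y in h0 p2P pP.
have -> : circulation X Y x x' y y' = circulation X Y x (x + w) y (y + h).
  by rewrite /w /h !(addrC _ (_ - _)) !subrK.
apply/ler_addgt0Pr => e e0; rewrite add0r.
(* All sides are at most [L]; the summand 1 keeps [L] positive for a degenerate
   rectangle. *)
pose L := w + h + 1.
have L0 : 0 < L by rewrite /L; lra.
(* The approximation with error [e / k * |h|] bounds a circulation at scale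
   [L / 2 ^+ n] by [16 * (e / k * 2 * L / 2 ^+ n) * (L / 2 ^+ n)], that is [e / 4 ^+ n]. *)
pose k := 32 * L ^+ 2.
have k0 : 0 < k by rewrite /k mulr_gt0// exprn_gt0.
have [d d0 dP] := bP _ (divr_gt0 e0 k0).
(* A corner of a square of size [s] is within [2 * s] of [p], less than [d]; the
   last two terms keep the small rectangle inside the open square. *)
pose rho := Num.min (d / 3) (Num.min (r - `|p1|) (r - `|p2|)).
have rho0 : 0 < rho by rewrite !lt_min !subr_gt0 p1r p2r divr_gt0.
have [n Ln] : exists n, L / 2 ^+ n < rho.
  exists (Num.bound (L / rho)); rewrite ltr_pdivrMr ?exprn_gt0//.
  by rewrite mulrC -ltr_pdivrMr//; exact: upper_nthrootP.
have [a0 [b0 [ap bp qle]]] := pP n.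
apply: (le_trans qle).
set s := L / 2 ^+ n in Ln.
have s0 : 0 < s by rewrite divr_gt0// exprn_gt0.
have ws : 0 <= w / 2 ^+ n <= s.
  by rewrite divr_ge0 ?exprn_ge0//= ler_pM2r ?invr_gt0 ?exprn_gt0// /L; lra.
have hs : 0 <= h / 2 ^+ n <= s.
  by rewrite divr_ge0 ?exprn_ge0//= ler_pM2r ?invr_gt0 ?exprn_gt0// /L; lra.
have [r1 r2 r3] : [/\ s < d / 3, s < r - `|p1| & s < r - `|p2|].
  by move: Ln; rewrite !lt_min => /andP[? /andP[? ?]].
have [p1n p2n] := (ler_norm p1, ler_norm p2).
have [p1n' p2n'] := (ler_norm (- p1), ler_norm (- p2)); rewrite !normrN in p1n' p2n'.
have : q a0 b0 (w / 2 ^+ n) (h / 2 ^+ n) <= 16 * (e / k * (2 * s)) * s.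
  apply: (@circulation_le r f X Y (p1 +i* p2) (f (p1 +i* p2)) b s) => //.
  - move=> z _ [/= z1 z2].
    have zs : cmod (z - (p1 +i* p2)) <= 2 * s.
      by rewrite (le_trans (cmod_le _))// !raddfB/=; lra.
    have := dP (z - (p1 +i* p2)); rewrite (addrC _ (z - _)) subrK => H.
    apply: (le_trans (H _)); first lra.
    by rewrite ler_wpM2l// divr_ge0 ?ltW.
  - by rewrite mulr_ge0// ?divr_ge0 ?mulr_ge0 ?ltW.
  - by split; rewrite /= ltr_norml; lra.
  - by split; rewrite /= ltr_norml; lra.
  - by split; rewrite /= ler_norml; lra.
  - by split; rewrite /= ler_norml; lra.
move=> /(ler_wpM2l (exprn_ge0 n (ler0n R 4))) H; apply: (le_trans H).
rewrite /s /k le_eqVlt; apply/orP; left; apply/eqP.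
have -> : (4 : R) ^+ n = 2 ^+ n * 2 ^+ n by rewrite -exprMn; congr (_ ^+ _); ring.
by field; rewrite expf_neq0//= gt_eqF.
Qed.

End circulation.

(** * Second-order expansions *)

Section second_order.
Context {R : realType}.
Local Notation C := (Cplx R).
Implicit Types (f F G phi : C -> C) (z p a b : C).

(** A primitive is obtained by integrating along a horizontal, then a vertical
    segment from the origin. By Goursat's lemma its increment between two points
    is also the integral along the two-segment path that joins them. *)
Lemma holomorphic_primitive (r : R) f :
  (forall z, closed_square 0 r z -> derivable f z 1) ->
  exists F, forall p a b d K, 0 <= K ->
    (forall z, open_square r z -> closed_square p d z ->
       cmod (f z - (a + b * (z - p))) <= K) ->
    forall z w, open_square r z -> open_square r w ->
      closed_square p d z -> closed_square p d w ->
      cmod (F w - F z - (affine_primitive p a b w - affine_primitive p a b z))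
        <= 8 * K * d.
Proof.
move=> df.
have [z zr|X [Y XY]] := @axis_primitives _ r f.
  exact/differentiable_continuous/derivable1_diffP/df.
exists (fun z => X (complex.Re z) 0 - X 0 0 +
                 (Y (complex.Re z) (complex.Im z) - Y (complex.Re z) 0)).
move=> p a b d K K0 fK [x y] [x' y'] [/= xr yr] [/= xr' yr'] [/= xd yd] [/= xd' yd'].
have [XP YP] := XY _ _ _ _ _ fK.
set Q := affine_primitive p a b in XP YP *.
have r0 : `|0 : R| < r by rewrite normr0 (le_lt_trans _ xr).
have J0 : circulation X Y x x' 0 y = 0.
  apply: (goursat XY) (conj xr r0) (conj xr' yr) => z [zr zr'].
  by apply/derivable_affine_approx/df; rewrite /closed_square/= !subr0 !ltW.
(* The two sides differ by the circulation around a rectangle on the real axis. *)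
have -> : X x' 0 - X 0 0 + (Y x' y' - Y x' 0) - (X x 0 - X 0 0 + (Y x y - Y x 0)) -
    (Q (x' +i* y') - Q (x +i* y)) =
    (X x' y - X x y - (Q (x' +i* y) - Q (x +i* y))) +
    (Y x' y' - Y x' y - (Q (x' +i* y') - Q (x' +i* y))).
  by apply/eqP; rewrite -subr_eq0 -J0 /circulation; apply/eqP; ring.
have xx : `|x' - x| <= 2 * d by move: xd xd'; rewrite !ler_norml; lra.
have yy : `|y' - y| <= 2 * d by move: yd yd'; rewrite !ler_norml; lra.
have h1 := XP x x' y (conj xr yr) (conj xr' yr) (conj xd yd) (conj xd' yd).
have h3 := YP x' y y' (conj xr' yr) (conj xr' yr') (conj xd' yd) (conj xd' yd').
apply: (le_trans (cmodD _ _)).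
have := ler_wpM2l (mulr_ge0 (ler0n R 2) K0) xx.
have := ler_wpM2l (mulr_ge0 (ler0n R 2) K0) yy.
lra.
Qed.

(** A Taylor expansion of order two whose remainder is [o(h^2)]: the second
    coefficient is [phi 0], and continuity of [phi] at [0] controls the remainder.
    In this form, products and inverses are obtained by algebra. *)
Definition expands2 F p a := exists2 phi, {for 0, continuous phi} &
  \forall h \near (0 : C), F (p + h) = F p + a * h + h ^+ 2 * phi h.

Lemma continuous_cmodP F p : {for p, continuous F} <->
  forall e : R, 0 < e -> exists2 d : R, 0 < d & forall h, cmod h < d -> cmod (F (p + h) - F p) <= e.
Proof.
split=> [Fc e e0|FP].
  have /Fc : nbhs (F p) [set w | cmod (w - F p) <= e].
    by apply/nbhs_cmodP; exists e => // h he /=; rewrite addrC addKr ltW.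
  by move=> /nbhs_cmodP.
move=> P /nbhs_cmodP[e e0 eP].
have /FP[d d0 dP] : 0 < e / 2 by rewrite divr_gt0.
apply/nbhs_cmodP; exists d => // h /dP hd /=.
have -> : F (p + h) = F p + (F (p + h) - F p) by rewrite (addrC (F p)) subrK.
by apply: eP; lra.
Qed.

(** The primitive [F] is close to an antiderivative of the first-order expansion
    of [f], so it gains one order of expansion over [f]. *)
Lemma primitive_expands2 (r : R) f : 0 < r ->
  (forall z, closed_square 0 r z -> derivable f z 1) ->
  exists F, (forall p, open_square r p -> expands2 F p (f p)) /\
    ((exists2 d : R, 0 < d & forall z, closed_square 0 d z -> f z = 0) ->
     \forall z \near (0 : C), F z = F 0).
Proof.
move=> r0 df; have [F FP] := holomorphic_primitive df; exists F; split.
- move=> p [p1r p2r].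
  have [b bP] : exists b, affine_approx f p b.
    by apply/derivable_affine_approx/df; rewrite /closed_square/= !subr0 !ltW.
  pose phi h := if h == 0 then b / 2 else (F (p + h) - F p - f p * h) / h ^+ 2.
  exists phi; last first.
    apply: filterE => h; rewrite /phi; case: eqVneq => [->|h0].
      by rewrite expr0n mul0r mulr0 !addr0.
    by field.
  apply/continuous_cmodP => e e0.
  (* On the square of half side [|h|] the affine approximation has error at most
     [e / 16 * (2 * |h|)], and increments of [F] multiply it by [8 * |h|]. *)
  have [d d0 dP] := bP _ (divr_gt0 e0 (ltr0n R 16)).
  pose rho := Num.min (d / 3) (Num.min (r - `|complex.Re p|) (r - `|complex.Im p|)).
  have rho0 : 0 < rho by rewrite !lt_min !subr_gt0 p1r p2r divr_gt0.
  exists rho => // h hrho; rewrite add0r /phi eqxx; case: eqVneq => [_|h0].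
    by rewrite subrr cmod0 ltW.
  have ch0 : 0 < cmod h by rewrite lt_def cmod_ge0 cmod_eq0 h0.
  have [r1 r2 r3] : [/\ cmod h < d / 3, cmod h < r - `|complex.Re p| &
      cmod h < r - `|complex.Im p|].
    by move: hrho; rewrite !lt_min => /andP[? /andP[? ?]].
  have sp : closed_square p (cmod h) p by split; rewrite subrr normr0 ltW.
  have sph := cmod_le_closed_square p (lexx (cmod h)).
  have oph : open_square r (p + h).
    split; rewrite raddfD/= (le_lt_trans (ler_normD _ _))//.
      by have := ler_Re h; lra.
    by have := ler_Im h; lra.
  have := FP p (f p) b (cmod h) (e / 16 * (2 * cmod h)) _ _ p (p + h) (conj p1r p2r) oph sp sph.
  have -> : F (p + h) - F p - (affine_primitive p (f p) b (p + h) - affine_primitive p (f p) b p)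
     = ((F (p + h) - F p - f p * h) / h ^+ 2 - b / 2) * h ^+ 2.
    by rewrite /affine_primitive; field.
  rewrite cmodM cmodX => H.
  rewrite -(ler_pM2r (exprn_gt0 2 ch0)); apply: le_trans (H _ _) _.
  + by rewrite mulr_ge0// ?divr_ge0 ?mulr_ge0 ?ltW.
  + move=> z _ [z1 z2].
    have zs : cmod (z - p) <= 2 * cmod h.
      by rewrite (le_trans (cmod_le _))// !raddfB/=; lra.
    have := dP (z - p); rewrite (addrC p) subrK => H'.
    apply: (le_trans (H' _)); first lra.
    by rewrite ler_wpM2l// divr_ge0 ?ltW.
  + by rewrite le_eqVlt; apply/orP; left; apply/eqP; field.
- move=> [d d0 f0].
  apply/nbhs_cmodP; exists (Num.min d r); first by rewrite lt_min d0.
  move=> h; rewrite lt_min add0r => /andP[hd hr].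
  have := FP 0 0 0 d 0 (lexx 0) _ 0 h.
  have aff (w : C) : affine_primitive 0 0 0 w = 0 by rewrite /affine_primitive; ring.
  rewrite !aff => H; apply/eqP; rewrite -subr_eq0 -cmod_eq0 eq_le cmod_ge0 andbT.
  rewrite !subr0 mulr0 mul0r in H; apply: H.
  + by move=> z _ /f0 ->; rewrite mul0r addr0 subrr cmod0.
  + by split; rewrite /= normr0.
  + by split; [exact: le_lt_trans (ler_Re _) hr|exact: le_lt_trans (ler_Im _) hr].
  + by split; rewrite /= subrr normr0 ltW.
  + by rewrite -(add0r h); exact/cmod_le_closed_square/ltW.
Qed.

Lemma expands2_near F G p a :
  (\forall z \near p, F z = G z) -> expands2 F p a -> expands2 G p a.
Proof.
move=> FG [phi phic Fphi]; exists phi => //.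
have FGp : F p = G p by exact: (@nbhs_singleton _ p [set z | F z = G z] FG).
move: FG => /nbhs_cmodP[d d0 dP]; rewrite -FGp.
have : \forall h \near (0 : C), F (p + h) = G (p + h).
  by apply/nbhs_cmodP; exists d => // h; rewrite add0r; exact: dP.
by apply: filterS2 Fphi => h -> ->.
Qed.

Lemma continuous_cst_at (c : C) p : {for p, continuous (fun=> c : C)}.
Proof. exact: cst_continuous. Qed.

Lemma continuous_id_at p : {for p, continuous (fun z : C => z)}.
Proof. exact: cvg_id. Qed.

Lemma continuous_add_at F G p : {for p, continuous F} -> {for p, continuous G} ->
  {for p, continuous (fun z => F z + G z)}.
Proof. by move=> Fc Gc; exact: cvgD Fc Gc. Qed.

Lemma continuous_mul_at F G p : {for p, continuous F} -> {for p, continuous G} ->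
  {for p, continuous (fun z => F z * G z)}.
Proof. by move=> Fc Gc; exact: cvgM Fc Gc. Qed.

Lemma expands2_cst c p : expands2 (fun=> c) p 0.
Proof.
exists (fun=> 0); first exact: continuous_cst_at.
by apply: filterE => h; rewrite mul0r mulr0 !addr0.
Qed.

Lemma expands2_mul F G p a b : expands2 F p a -> expands2 G p b ->
  expands2 (fun z => F z * G z) p (F p * b + a * G p).
Proof.
move=> [phi phic Fphi] [psi psic Gpsi].
exists (fun h => F p * psi h + a * b + phi h * G p +
  h * (a * psi h + phi h * b) + h ^+ 2 * (phi h * psi h)).
  have cst u := @continuous_cst_at u 0; have id0 := @continuous_id_at 0.
  have c1 := continuous_add_at (continuous_mul_at (cst (F p)) psic) (cst (a * b)).
  have c2 := continuous_add_at c1 (continuous_mul_at phic (cst (G p))).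
  have c3 := continuous_add_at (continuous_mul_at (cst a) psic)
                               (continuous_mul_at phic (cst b)).
  have c4 := continuous_add_at c2 (continuous_mul_at id0 c3).
  exact: (continuous_add_at c4 (continuous_mul_at (continuous_mul_at id0 id0)
                                                  (continuous_mul_at phic psic))).
by apply: filterS2 Fphi Gpsi => h -> ->; ring.
Qed.

Lemma expands2_inv p : p != 0 -> exists a, expands2 (fun z => z^-1) p a.
Proof.
move=> p0; exists (- p ^- 2); exists (fun h => (p ^+ 2 * (p + h))^-1).
  have c := continuous_mul_at (@continuous_cst_at (p ^+ 2) 0)
    (continuous_add_at (@continuous_cst_at p 0) (@continuous_id_at 0)).
  have c0 : p ^+ 2 * (p + 0) != 0 by rewrite addr0 mulf_neq0 ?expf_neq0.
  exact: (cvgV c0 c).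
have : \forall h \near (0 : C), p + h != 0.
  apply/nbhs_cmodP; exists (cmod p); first by rewrite lt_def cmod_ge0 cmod_eq0 p0.
  move=> h; rewrite add0r => hp; apply: contraTneq hp => ph0.
  by rewrite -leNgt -cmodN -[- p]addr0 -ph0 addKr.
by apply: filterS => h ph0; field; rewrite ph0 p0.
Qed.

Lemma expands2_continuous F p a : expands2 F p a -> {for p, continuous F}.
Proof.
move=> [phi phic /nbhs_cmodP[d d0 dP]].
have : {for 0, continuous (fun h => F p + a * h + h ^+ 2 * phi h)}.
  have cst u := @continuous_cst_at u 0; have id0 := @continuous_id_at 0.
  have c1 := continuous_add_at (cst (F p)) (continuous_mul_at (cst a) id0).
  exact: (continuous_add_at c1 (continuous_mul_at (continuous_mul_at id0 id0) phic)).
move=> /continuous_cmodP H; apply/continuous_cmodP => e /H[d' d'0 d'P].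
exists (Num.min d d'); first by rewrite lt_min d0.
move=> h; rewrite lt_min => /andP[/dP + /d'P].
by rewrite !add0r => ->; rewrite expr0n mulr0 mul0r !addr0.
Qed.

(** The linear coefficient of an expansion is unique. *)
Lemma expands2_locally_constant F p a c :
  (\forall z \near p, F z = c) -> expands2 F p a -> a = 0.
Proof.
move=> Fc [phi phic Fphi].
have Fp : F p = c by exact: (@nbhs_singleton _ p [set z | F z = c] Fc).
have /nbhs_cmodP[d d0 dP] : \forall h \near (0 : C), a * h + h ^+ 2 * phi h = 0.
  move: Fc => /nbhs_cmodP[d d0 dP].
  have : \forall h \near (0 : C), F (p + h) = c.
    by apply/nbhs_cmodP; exists d => // h; rewrite add0r; exact: dP.
  apply: filterS2 Fphi => h -> /eqP; rewrite Fp -addrA -subr_eq0 (addrC c) addrK.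
  by move=> /eqP.
have : {for 0, continuous (fun h : C => a + h * phi h)}.
  exact: (continuous_add_at (@continuous_cst_at a 0)
                            (continuous_mul_at (@continuous_id_at 0) phic)).
move=> /continuous_cmodP H; apply/eqP; rewrite -cmod_eq0 eq_le cmod_ge0 andbT.
apply/ler_addgt0Pr => e /H[d' d'0 d'P]; rewrite add0r.
pose m := Num.min d d' / 2.
have m0 : 0 < m by rewrite divr_gt0// lt_min d0.
have [md md'] : m < d /\ m < d'.
  have : 0 < Num.min d d' by rewrite lt_min d0.
  have : Num.min d d' <= d by rewrite ge_min lexx.
  have : Num.min d d' <= d' by rewrite ge_min lexx orbT.
  by rewrite /m; split; lra.
have cm : cmod (m%:C : C) = m by rewrite cmodR gtr0_norm.
have mC0 : (m%:C : C) != 0 by rewrite -cmod_eq0 cm gt_eqF.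
have := dP m%:C; rewrite cm add0r => /(_ md) am.
have := d'P m%:C; rewrite cm add0r mul0r addr0 => /(_ md').
have -> : a + m%:C * phi m%:C = 0.
  by apply: (mulIf mC0); rewrite mul0r -am; ring.
by rewrite sub0r cmodN.
Qed.

End second_order.

(** * Maximum principle and identity theorem *)

Section identity.
Context {R : realType}.
Local Notation C := (Cplx R).
Implicit Types (f F G phi : C -> C) (z p a b : C).

Lemma continuous_Re : continuous (fun z : C => complex.Re z).
Proof.
move=> z P /nbhs_ballP[e e0 eP]; apply/nbhs_cmodP; exists e => // h he.
apply: eP; rewrite /ball/= -raddfB opprD addNKr.
by rewrite (le_lt_trans (ler_Re _))// cmodN.
Qed.

Lemma continuous_Im : continuous (fun z : C => complex.Im z).
Proof.
move=> z P /nbhs_ballP[e e0 eP]; apply/nbhs_cmodP; exists e => // h he.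
apply: eP; rewrite /ball/= -raddfB opprD addNKr.
by rewrite (le_lt_trans (ler_Im _))// cmodN.
Qed.

Lemma continuous_cmod : continuous (fun z : C => cmod z).
Proof.
move=> z P /nbhs_ballP[e e0 eP]; apply/nbhs_cmodP; exists e => // h he.
apply: eP; rewrite /ball/=; apply: le_lt_trans he.
have := cmodD z h; have := cmodD (z + h) (- h); rewrite addrK cmodN.
by rewrite ler_norml; lra.
Qed.

(** Compactness is transported from the product of two real segments. *)
Lemma closed_square_EVT (r : R) (g : C -> R) : 0 <= r ->
  (forall z, closed_square 0 r z -> {for z, continuous g}) ->
  exists2 c, closed_square 0 r c & forall z, closed_square 0 r z -> g z <= g c.
Proof.
move=> r0 gc.
pose toC (u : R * R) : C := u.1 +i* u.2.
have toC_cts : continuous toC.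
  move=> [x y] P /nbhs_cmodP[e e0 eP].
  apply/nbhs_ballP; exists (e / 2); first by rewrite /= divr_gt0.
  move=> [x' y'] [/= xx yy]; rewrite /toC/=.
  have -> : (x' +i* y' : C) = x +i* y + ((x' - x) +i* (y' - y)).
    by apply/eqP; rewrite eq_complex/=; apply/andP; split; apply/eqP; ring.
  apply: eP; rewrite (le_lt_trans (cmod_le _))//=.
  by move: xx yy; rewrite /ball/= (distrC x) (distrC y); lra.
pose K := `[- r, r]%classic `*` `[- r, r]%classic.
have KP u : K u <-> closed_square 0 r (toC u).
  by rewrite /K /closed_square /toC/= !in_itv/= !subr0 !ler_norml.
have cK : compact K by apply: compact_setX; exact: segment_compact.
have [|||c cK' cmax] := @compact_EVT_max _ R (g \o toC) K.
- by exists (0, 0); apply/KP; rewrite /closed_square/= !subr0 normr0.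
- exact: cK.
- apply: continuous_in_subspaceT => u /set_mem /KP /gc gcu.
  by apply: continuous_comp; [exact: toC_cts|exact: gcu].
exists (toC c); first exact/KP/set_mem.
move=> [x y] xy; have /= := cmax (x, y); apply; apply/mem_set/KP.
exact: xy.
Qed.

(** Maximum principle. The mean of [G] over [c + t], [c - t], [c + i t], [c - i t]
    differs from [G c] by [o(t^2)], because the squares of [1, -1, i, -i] sum to [0],
    while the mean of [|z|^2] exceeds [|c|^2] by [t^2]. So the sum of [Re G] and a
    small positive multiple of [|z|^2] cannot have an interior maximum. *)
Lemma max_Re (r M : R) G : 0 < r ->
  (forall z, closed_square 0 r z -> {for z, continuous G}) ->
  (forall z, open_square r z -> exists a, expands2 G z a) ->
  (forall z, closed_square 0 r z -> ~ open_square r z -> complex.Re (G z) <= M) ->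
  forall z, closed_square 0 r z -> complex.Re (G z) <= M.
Proof.
move=> r0 Gc Ge GM z1 z1r; rewrite leNgt; apply/negP => Mz1.
(* Chosen so that the perturbation, at most [2 * eta * r ^+ 2] on the square, is
   half the excess of [G] at [z1] over its bound on the boundary. *)
pose eta := (complex.Re (G z1) - M) / (4 * r ^+ 2).
have r20 : 0 < r ^+ 2 by rewrite exprn_gt0.
have eta0 : 0 < eta by rewrite divr_gt0 ?subr_gt0 ?mulr_gt0.
have etaE : eta * r ^+ 2 * 4 = complex.Re (G z1) - M.
  by rewrite /eta; field; rewrite gt_eqF.
pose q (z : C) : R := complex.Re z ^+ 2 + complex.Im z ^+ 2.
pose u z := complex.Re (G z) + eta * q z.
have [z zr|c cr cmax] := @closed_square_EVT r u (ltW r0).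
  have Gz : {for z, continuous (fun w => complex.Re (G w))}.
    exact: (continuous_comp (Gc _ zr) (@continuous_Re (G z))).
  have qz : {for z, continuous q}.
    have Rz := @continuous_Re z; have Iz := @continuous_Im z.
    exact: (cvgD (cvgM Rz Rz) (cvgM Iz Iz)).
  exact: (cvgD Gz (cvgM (@cst_continuous _ _ eta z) qz)).
have cO : open_square r c.
  apply: contrapT => cNO; have := cmax _ z1r; have := GM _ cr cNO.
  have : q c <= r ^+ 2 + r ^+ 2.
    by case: cr; rewrite !subr0 => ? ?; rewrite lerD// -real_normK ?num_real// lerXn2r// nnegrE// ltW.
  move=> /(ler_wpM2l (ltW eta0)).
  have : 0 <= eta * q z1 by rewrite mulr_ge0 ?(ltW eta0)// addr_ge0 ?sqr_ge0.
  rewrite /u; have := mulr_gt0 eta0 r20; lra.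
have [a [phi phic /nbhs_cmodP[d d0 dP]]] := Ge c cO.
have [d' d'0 d'P] := (continuous_cmodP phi 0).1 phic _ (divr_gt0 eta0 (ltr0n R 2)).
have [c1 c2] := cO.
pose rho := Num.min (Num.min d d') (Num.min (r - `|complex.Re c|) (r - `|complex.Im c|)).
have rho0 : 0 < rho by rewrite !lt_min !subr_gt0 c1 c2 d0 d'0.
pose t := rho / 2.
have t0 : 0 < t by rewrite divr_gt0.
have : t < rho by rewrite /t; lra.
rewrite !lt_min => /andP[/andP[td td'] /andP[t1 t2]].
have ct : cmod (t%:C : C) = t by rewrite cmodR gtr0_norm.
have cit : cmod ('i * t%:C : C) = t by rewrite cmodM cmod_i mul1r.
have pt h : cmod h = t -> [/\ u (c + h) <= u c, G (c + h) = G c + a * h + h ^+ 2 * phi h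
   & cmod (phi h - phi 0) <= eta / 2].
  move=> ht; split.
  - apply: cmax; split; rewrite subr0 raddfD/= (le_trans (ler_normD _ _))//.
      by have := ler_Re h; lra.
    by have := ler_Im h; lra.
  - by have := dP h; rewrite add0r ht; exact.
  - by have := d'P h; rewrite add0r ht; exact.
have [u1 G1 p1] := pt _ ct.
have [u2 G2 p2] := pt _ (etrans (cmodN _) ct).
have [u3 G3 p3] := pt _ cit.
have [u4 G4 p4] := pt _ (etrans (cmodN _) cit).
have qE : q (c + t%:C) + q (c + - t%:C) + (q (c + 'i * t%:C) + q (c + - ('i * t%:C))) = 4 * q c + 4 * t ^+ 2.
  by rewrite /q; case: (c) => x y /=; ring.
pose s := (phi t%:C - phi 0) + (phi (- t%:C) - phi 0) -
  ((phi ('i * t%:C) - phi 0) + (phi (- ('i * t%:C)) - phi 0)).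
have GE : G (c + t%:C) + G (c + - t%:C) + (G (c + 'i * t%:C) + G (c + - ('i * t%:C))) =
    G c + G c + (G c + G c) + (t ^+ 2)%:C * s.
  by rewrite G1 G2 G3 G4 !sqrrN exprMn sqri rmorphXn/= /s; ring.
have ReZ (x : R) (z : C) : complex.Re (x%:C * z) = x * complex.Re z.
  by case: z => ? ? /=; ring.
have s_le : cmod s <= 2 * eta.
  rewrite (le_trans (cmodD _ _))// cmodN (le_trans (lerD (cmodD _ _) (cmodD _ _)))//.
  by lra.
have Res := le_trans (ler_Re s) s_le.
have := congr1 (@complex.Re R) GE; rewrite !raddfD/= ReZ => {}GE.
have t20 : 0 < t ^+ 2 by rewrite exprn_gt0.
have : t ^+ 2 * (- (2 * eta)) <= t ^+ 2 * complex.Re s.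
  by rewrite ler_pM2l//; move: Res; rewrite ler_norml => /andP[].
have := mulr_gt0 t20 eta0; move: (congr1 ( *%R eta) qE).
move: u1 u2 u3 u4 GE; rewrite /u; lra.
Qed.

(** Apply [max_Re] to [c * G], where [c] is the conjugate of the value of [G] at the
    point considered. *)
Lemma max_cmod (r M : R) G : 0 < r ->
  (forall z, closed_square 0 r z -> {for z, continuous G}) ->
  (forall z, open_square r z -> exists a, expands2 G z a) ->
  (forall z, closed_square 0 r z -> ~ open_square r z -> cmod (G z) <= M) ->
  forall z, closed_square 0 r z -> cmod (G z) <= M.
Proof.
move=> r0 Gc Ge GM z zr.
have [->|Gz0] := eqVneq (cmod (G z)) 0.
  have rr : closed_square 0 r (r%:C : C).
    by split; rewrite /= subr0 ?normr0 ?gtr0_norm// ltW.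
  apply: le_trans (cmod_ge0 (G r%:C)) (GM _ rr _) => -[/=].
  by rewrite gtr0_norm// ltxx.
have Gz : 0 < cmod (G z) by rewrite lt_def Gz0 cmod_ge0.
pose c := (G z)^*.
have cc : cmod c = cmod (G z) by rewrite /c /cmod; case: (G z) => x y /=; rewrite sqrrN.
have := @max_Re r (cmod (G z) * M) (fun w => c * G w) r0 _ _ _ z zr.
have -> : complex.Re (c * G z) = cmod (G z) * cmod (G z).
  rewrite -expr2 /c /cmod; case: (G z) => x y /=.
  by rewrite sqr_sqrtr ?addr_ge0 ?sqr_ge0//; ring.
rewrite ler_pM2l//; apply.
- by move=> w /Gc Gw; exact: (continuous_mul_at (@continuous_cst_at _ c w) Gw).
- move=> w /Ge[a Ga]; eexists; exact: expands2_mul (expands2_cst c w) Ga.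
- move=> w wr wO; rewrite (le_trans (ler_norm _))// (le_trans (ler_Re _))//.
  by rewrite cmodM cc ler_wpM2l ?cmod_ge0// GM.
Qed.

(** A primitive [F] of [f] is constant near [0], so that the quotient of [F - F 0] by
    [z ^+ n] has second-order expansions everywhere, for all [n]. The maximum
    principle bounds it by [M / rho ^+ n], whence [|F z - F 0| <= M * (|z| / rho) ^+ n]
    for all [n], and [F] is constant on the disc. *)
Lemma vanishing_spreads (r rho : R) f : 0 < rho -> rho < r ->
  (forall z, closed_square 0 r z -> derivable f z 1) ->
  (exists2 d : R, 0 < d & forall z, closed_square 0 d z -> f z = 0) ->
  forall z, cmod z < rho -> f z = 0.
Proof.
move=> rho0 rhor df f0; have r0 := lt_trans rho0 rhor.
have [F [Fe F0]] := primitive_expands2 r0 df; have {}F0 := F0 f0.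
have sub z : closed_square 0 rho z -> open_square r z.
  by move=> []; rewrite !subr0 => ? ?; split; apply: le_lt_trans rhor.
have [z zr|m _ mmax] := @closed_square_EVT rho (fun z => cmod (F z - F 0)) (ltW rho0).
  have Fz := expands2_continuous (Fe z (sub z zr)).
  have FF0 := continuous_add_at Fz (@continuous_cst_at _ (- F 0) z).
  exact: (continuous_comp FF0 (@continuous_cmod (F z - F 0))).
set M := cmod (F m - F 0) in mmax.
(* As [0^-1 = 0], this vanishes at [0] for [n > 0], in agreement with its values
   near [0]; for [n = 0] the first factor vanishes there. *)
pose G n z := (F z - F 0) * z^-1 ^+ n.
have Ge n z : open_square r z -> exists a, expands2 (G n) z a.
  move=> zr; have [->|z0] := eqVneq z 0.
    exists 0; apply: expands2_near (expands2_cst 0 0).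
    by apply: filterS F0 => w Fw; rewrite /G Fw subrr mul0r.
  have [b Fb] : exists b, expands2 (fun z => F z - F 0) z b.
    have [phi phic Fphi] := Fe z zr; exists (f z); exists phi => //.
    by apply: filterS Fphi => h ->; ring.
  elim: n => [|n [a IH]].
    by exists b; apply: expands2_near Fb; apply: filterE => w; rewrite /G expr0 mulr1.
  have [c ic] := expands2_inv z0; eexists.
  apply: expands2_near (expands2_mul IH ic).
  by apply: filterE => w; rewrite /G exprSr mulrA.
have GM n z : closed_square 0 rho z -> cmod (G n z) <= M / rho ^+ n.
  apply: max_cmod => // {}z => [/sub /(Ge n)[a]|zr|zr zO].
  - exact: expands2_continuous.
  - by apply/Ge; case: zr => ? ?; split; exact: lt_trans rhor.
  - have rz : rho <= cmod z.
      rewrite leNgt; apply/negP => zrho; apply: zO.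
      by split; [exact: le_lt_trans (ler_Re _) zrho|exact: le_lt_trans (ler_Im _) zrho].
    have z0 : 0 < cmod z by exact: lt_le_trans rz.
    have zn0 : z != 0 by rewrite -cmod_eq0 gt_eqF.
    have zi : cmod z^-1 = (cmod z)^-1.
      apply: (mulfI (lt0r_neq0 z0)); rewrite -cmodM (divff zn0) divff ?gt_eqF//.
      by rewrite -[1]/(1%:C) cmodR normr1.
    rewrite /G cmodM cmodX zi -exprVn ler_pM ?cmod_ge0 ?exprn_ge0 ?invr_ge0 ?cmod_ge0//.
      exact: mmax.
    by rewrite lerXn2r ?nnegrE ?invr_ge0 ?cmod_ge0 ?(ltW rho0)// lef_pV2.
have FF z : cmod z < rho -> F z = F 0.
  move=> zrho; apply/eqP; rewrite -subr_eq0 -cmod_eq0 eq_le cmod_ge0 andbT.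
  have [->|z0] := eqVneq z 0; first by rewrite subrr cmod0.
  have zs : closed_square 0 rho z.
    by rewrite -[z]add0r; exact/cmod_le_closed_square/ltW.
  have le_n n : cmod (F z - F 0) <= M * (cmod z / rho) ^+ n.
    have -> : F z - F 0 = G n z * z ^+ n by rewrite /G exprVn divfK ?expf_neq0.
    have := ler_wpM2r (exprn_ge0 n (cmod_ge0 z)) (GM n z zs).
    by rewrite cmodM cmodX expr_div_n mulrAC -mulrA.
  have q1 : `|cmod z / rho| < 1.
    by rewrite ger0_norm ?divr_ge0 ?cmod_ge0 ?(ltW rho0)// ltr_pdivrMr// mul1r.
  have : (M * (cmod z / rho) ^+ n) @[n --> \oo] --> M * 0.
    by apply: cvgM; [exact: cvg_cst|exact: cvg_expr].
  rewrite mulr0 => /cvgr_to_ge; apply; exact: filterE.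
move=> z zrho.
apply: (@expands2_locally_constant _ F z _ (F 0)); last first.
  by apply/Fe; split; apply: le_lt_trans (lt_trans zrho rhor); [exact: ler_Re|exact: ler_Im].
apply/nbhs_cmodP; exists (rho - cmod z); first by rewrite subr_gt0.
by move=> h hz; apply: FF; rewrite (le_lt_trans (cmodD _ _))//; lra.
Qed.

Lemma derivable_shift f p z : derivable f (p + z) 1 ->
  derivable (fun w => f (p + w)) z 1.
Proof.
rewrite /derivable.
suff -> : (fun h : C => h^-1 *: (f (p + (h *: 1 + z)) - f (p + z))) =
  (fun h : C => h^-1 *: (f (h *: 1 + (p + z)) - f (p + z))) by [].
by apply/funext => h; rewrite addrCA.
Qed.

(** The points of [Omega] near which [f] vanishes form a relatively open set; it is
    relatively closed because the vanishing spreads from a point to a disc whose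
    radius depends only on the distance to the complement of [Omega]. *)
Theorem identity_theorem (Omega : set C) f : open Omega -> connected Omega ->
  holomorphic_on Omega f ->
  (exists2 p, Omega p & \forall z \near p, f z = 0) ->
  forall z, Omega z -> f z = 0.
Proof.
move=> oO cO hf [p Op fp].
pose Z : set C := interior [set z | f z = 0].
suff E : Omega `&` Z = Omega.
  by move=> z; rewrite -E => -[_ /nbhs_singleton].
apply: cO.
- by exists p; split.
- by exists Z => //; exact: open_interior.
exists (closure (Omega `&` Z)); first exact: closed_closure.
apply/seteqP; split=> [z OZz|z [Oz Zz]].
  by split; [exact: (proj1 OZz)|exact: (@subset_closure _ (Omega `&` Z) z OZz)].
split; first exact: Oz.
have /nbhs_cmodP[e e0 eP] : nbhs z Omega := open_nbhs_nbhs (conj oO Oz).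
(* The disc of radius [e * 3 / 16] about [q] contains the disc of radius [e / 16]
   about [z], and the square of half side [e / 4] about [q] stays in [Omega]. *)
have [q [[Oq Zq] qz]] : (Omega `&` Z) `&` [set w | cmod (w - z) < e / 8] !=set0.
  apply: Zz; apply/nbhs_cmodP; exists (e / 8); first by rewrite divr_gt0.
  by move=> h; rewrite /= addrC addKr.
have /nbhs_cmodP[d d0 dP] := Zq.
have ff w : cmod w < e * 3 / 16 -> f (q + w) = 0.
  apply: (@vanishing_spreads (e / 4) (e * 3 / 16) (fun w => f (q + w))).
  - by lra.
  - by lra.
  - move=> {}w [w1 w2]; apply/derivable_shift/hf.
    have -> : q + w = z + ((q - z) + w) by ring.
    apply: eP; rewrite (le_lt_trans (cmodD _ _))//.
    have := cmod_le w; move: w1 w2 qz; rewrite /= !subr0; lra.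
  - exists (d / 3); first by lra.
    move=> {}w [w1 w2]; apply: dP.
    have := cmod_le w; move: w1 w2; rewrite /= !subr0; lra.
apply/nbhs_cmodP; exists (e / 16); first by lra.
move=> h he /=.
have -> : z + h = q + (h - (q - z)) by ring.
apply: ff; rewrite (le_lt_trans (cmodD _ _))// cmodN; move: qz => /=; lra.
Qed.

End identity.

(** * Products of nonzero functions and the annihilator *)

Section zero_divisors.
Context {R : realType}.
Local Notation C := (Cplx R).
Implicit Types f g : C -> C.

(** If the product vanishes, [g] vanishes near any point where [f] does not. *)
Lemma holomorphic_zero_divisor_free (Omega : set C) f g :
  open Omega -> connected Omega ->
  holomorphic_on Omega f -> holomorphic_on Omega g ->
  (exists2 z, Omega z & f z != 0) -> (exists2 z, Omega z & g z != 0) ->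
  exists2 z, Omega z & f z * g z != 0.
Proof.
move=> oO cO hf hg [p Op fp] [q Oq gq]; apply: contrapT => fg0.
suff g0 : forall z, Omega z -> g z = 0 by move: gq; rewrite g0// eqxx.
apply: (identity_theorem oO cO hg); exists p => //.
have fc : {for p, continuous f}.
  exact/differentiable_continuous/derivable1_diffP/hf.
have f0 : \forall z \near p, f z != 0.
  exact: cvgr_neq0 fc fp.
have Op' : nbhs p Omega := open_nbhs_nbhs (conj oO Op).
apply: filterS2 f0 Op' => z fz Oz; apply/eqP; apply: contrapT => /negP gz.
by apply: fg0; exists z => //; rewrite mulf_neq0.
Qed.

Lemma nonzero_on_closure (Omega : set C) f :
  {within closure Omega, continuous f} ->
  (exists2 z, closure Omega z & f z != 0) -> exists2 z, Omega z & f z != 0.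
Proof.
move=> /subspace_continuousP fc [z Oz fz].
have f0 : \forall w \near within (closure Omega) (nbhs z), f w != 0.
  exact: cvgr_neq0 (fc z Oz) fz.
have [w [Ow /= fw]] := Oz _ f0.
by exists w => //; apply: fw; exact: subset_closure.
Qed.

End zero_divisors.

Theorem theorem3p10 (R : realType)
  (H : completeNormedModType (Cplx R)) (ip : {dot H for (@Num.conj (Cplx R))})
  (norm_ip : forall x : H, `|x| ^+ 2 = ip x x)
  (Omega : set (Cplx R)) (Omega_domain : analytic_domain Omega)
  (z0 : (Cplx R)) (Omega_z0 : Omega z0)
  (omega : probability (Cborel R) R)
  (omega_harmonic : harmonic_measure Omega z0 omega)
  (T : {linear H -> H}) (T_continuous : continuous T)
  (T_h : hypothesis_h ip Omega T)
  (Phi : ((Cplx R) -> (Cplx R)) -> {linear H -> H})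
  (Phi_calculus : Hinfty_calculus ip Omega omega T Phi)
  (A : set ((Cplx R) -> (Cplx R)))
  (A_algebra : function_algebra (closure Omega) A)
  (A_poly : forall p : {poly (Cplx R)}, A (fun z => p.[z]))
  (A_Hinfty : A `<=` Hinfty Omega)
  (H_T_module : hilbert_module (closure Omega) A (fun f => Phi f : H -> H))
  (k : nat) (h : 'I_k -> H)
  (h_generating : generating_set A (fun f => Phi f : H -> H) h)
  (h_algebraic : forall i, algebraic_element (closure Omega) A
                   (fun f => Phi f : H -> H) (h i)) :
  [set x : H | algebraic_element (closure Omega) A
                 (fun f => Phi f : H -> H) x] = [set: H] /\
  C0_operator Omega Phi.
Proof.
(* The product of annihilators of the generators annihilates them all, because
   the action is commutative; it is nonzero by the identity theorem. *)
have annihilator (s : seq 'I_k) : exists theta, [/\ A theta,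
    exists2 z, Omega z & theta z != 0 & forall i, i \in s -> Phi theta (h i) = 0].
  elim: s => [|i s [theta [Atheta theta0 theta_s]]].
    exists (fun=> 1); split=> //; first exact: (falg_cst A_algebra).
    by exists z0 => //; exact: oner_neq0.
  have [eta [Aeta eta0 eta_i]] := h_algebraic i.
  exists (fun z => theta z * eta z); split.
  - exact: (falg_mul A_algebra).
  - apply: holomorphic_zero_divisor_free.
    + exact: (domain_open Omega_domain).
    + exact: (domain_connected Omega_domain).
    + by have [] := A_Hinfty _ Atheta.
    + by have [] := A_Hinfty _ Aeta.
    + exact: theta0.
    + exact: (nonzero_on_closure (falg_continuous A_algebra Aeta) eta0).
  - move=> j; rewrite inE => /predU1P[->|js].
      by rewrite (hmod_mul H_T_module)// eta_i linear0.
    have -> : (fun z => theta z * eta z) = (fun z => eta z * theta z).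
      by apply/funext => z; rewrite mulrC.
    by rewrite (hmod_mul H_T_module)// theta_s// linear0.
have [theta [Atheta [z1 Oz1 theta_z1] theta_h]] := annihilator (enum 'I_k).
have theta_gen n (f : 'I_n -> Cplx R -> Cplx R) (delta : 'I_n -> 'I_k) :
    (forall i, A (f i)) -> Phi theta (\sum_(i < n) Phi (f i) (h (delta i))) = 0.
  move=> Af; rewrite linear_sum big1// => i _.
  rewrite -(hmod_mul H_T_module)//.
  have -> : (fun z => theta z * f i z) = (fun z => f i z * theta z).
    by apply/funext => z; rewrite mulrC.
  by rewrite (hmod_mul H_T_module)// theta_h ?mem_enum// linear0.
have theta_c : continuous (Phi theta).
  exact: (calc_continuous Phi_calculus (A_Hinfty _ Atheta)).
have theta0 x : Phi theta x = 0.
  apply: contrapT => /eqP tx0.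
  have oU : open [set y | Phi theta y != 0].
    by rewrite openE => y /= ty; exact: cvgr_neq0 (theta_c y) ty.
  have [y [/= ty [n [f [delta [Af yE]]]]]] := h_generating _ (ex_intro _ x tx0) oU.
  by move: ty; rewrite yE theta_gen// eqxx.
split.
  apply/seteqP; split=> // x _; exists theta; split=> //.
  by exists z1 => //; exact: subset_closure.
by exists theta; split=> //; [exact: A_Hinfty|exists z1].
Qed.
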